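(* Let $\Lambda$ be a locally finite partially ordered set and let $P$ be a commutative, absolute topological ring. Then the group $\mathrm{GL}_\Lambda(P)$ is residually solvable. If moreover $\Lambda$ is $n$-bounded, then $\mathrm{GL}_\Lambda(P)$ is solvable and $\mathrm{GL}_\Lambda(P)^{(n)}=\{1\}$.
   Context: A partially ordered set $(\Lambda,\preceq)$ is locally finite if all intervals $[s_1,s_2]=\{t: s_1\preceq t\preceq s_2\}$ are finite. It is $n$-bounded if for every $s\in\Lambda$ the set $\mathcal{N}_1(s)=\{t: t\preceq s\text{ or }s\preceq t\}$ has at most $n$ elements. Rings are associative with identity and nontrivial; topological rings are Hausdorff. A topological ring is absolute if its group of units with the subspace topology is a topological group. The incidence ring is $\mathrm{M}_\Lambda(P)=\{(a_{s_1,s_2})\in P^{\Lambda\times\Lambda}: a_{s_1,s_2}\neq 0\Rightarrow s_1\preceq s_2\}$ with coordinatewise addition and multiplication $(ab)_{s_1,s_2}=\sum_{t\in[s_1,s_2]}a_{s_1,t}b_{t,s_2}$. $\mathrm{GL}_\Lambda(P)$ is its group of units, a topological group with the subspace topology from the product topology on $P^{\Lambda\times\Lambda}$. The derived series of a topological group $G$ is defined by $G^{(0)}=G$ and $G^{(k+1)}=\overline{[G^{(k)},G^{(k)}]}$ (closure in $G$ of the commutator subgroup). $G$ is solvable if $G^{(k)}=\{1\}$ for some $k\in\mathbb{N}$, and residually solvable if $\bigcap_{k\in\mathbb{N}}G^{(k)}=\{1\}$. *)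

(* Defs.v *)
From HB Require Import structures.
From mathcomp Require Import all_boot all_order all_algebra finmap.
From mathcomp Require Import all_classical all_reals all_analysis.

Set Implicit Arguments.
Unset Strict Implicit.
Unset Printing Implicit Defensive.

Import Order.TTheory GRing.Theory.

Local Open Scope classical_set_scope.
Local Open Scope ring_scope.

Section Posets.
Context {d : Order.disp_t} (L : porderType d).

Definition order_interval (s1 s2 : L) : set L := [set t | (s1 <= t <= s2)%O].

Definition locally_finite : Prop :=
  forall s1 s2 : L, finite_set (order_interval s1 s2).

Definition comparables (s : L) : set L := [set t | (t <= s)%O \/ (s <= t)%O].

Definition n_bounded (n : nat) : Prop :=
  forall s : L, (comparables s #<= `I_n)%card.

End Posets.

(* As in the library's [PreTopologicalNmodule], the [PreTopological] structures
   below carry a topology and an algebraic structure without any compatibility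
   between the two. *)
#[short(type="preTopologicalGroupType")]
HB.structure Definition PreTopologicalGroup := {G of Topological G & Group G}.

#[short(type="preTopologicalPzRingType")]
HB.structure Definition PreTopologicalPzRing :=
  {R of Topological R & GRing.PzRing R}.

HB.mixin Record TopologicalZmodule_isTopologicalNzRing R
    of TopologicalZmodule R & GRing.NzRing R := {
  ring_mul_continuous : continuous (fun x : R * R => x.1 * x.2)
}.

#[short(type="topologicalNzRingType")]
HB.structure Definition TopologicalNzRing :=
  {R of TopologicalZmodule R & GRing.NzRing R
      & TopologicalZmodule_isTopologicalNzRing R}.

#[short(type="topologicalComNzRingType")]
HB.structure Definition TopologicalComNzRing :=
  {R of TopologicalNzRing R & GRing.ComNzRing R}.

Section TopologicalGroups.
Local Open Scope group_scope.
Variable G : preTopologicalGroupType.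
Implicit Types H A : set G.

Definition is_topological_group : Prop :=
  continuous (fun x : G * G => x.1 * x.2) /\ continuous (fun x : G => x^-1).

Definition is_subgroup H : Prop :=
  [/\ H 1, forall x y, H x -> H y -> H (x * y) & forall x, H x -> H x^-1].

Definition generated_subgroup A : set G := smallest is_subgroup A.

Definition commutator_subgroup H : set G :=
  generated_subgroup [set [~ x, y] | x in H & y in H].

Fixpoint derived_series (k : nat) : set G :=
  if k is k'.+1 then closure (commutator_subgroup (derived_series k'))
  else [set: G].

Definition solvable : Prop := exists k, derived_series k = [set 1].

Definition residually_solvable : Prop :=
  \bigcap_k derived_series k = [set 1].

End TopologicalGroups.

Arguments derived_series : clear implicits.

Section Units.
Variable R : pzRingType.

Definition is_unit : set R := [set x | exists y, x * y = 1 /\ y * x = 1].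

Definition units : Type := set_type is_unit.

HB.instance Definition _ := Choice.on units.

Let unit_mk (x : R) (ux : is_unit x) : units := SigSub (mem_set ux).

Lemma is_unit1 : is_unit 1.
Proof. by exists 1; rewrite mulr1. Qed.

Lemma is_unitM x y : is_unit x -> is_unit y -> is_unit (x * y).
Proof.
move=> [x' [xx' x'x]] [y' [yy' y'y]]; exists (y' * x'); split.
  by rewrite mulrA -(mulrA x) yy' mulr1.
by rewrite mulrA -(mulrA y') x'x mulr1.
Qed.

Let inv_ex (u : units) : {y : R | val u * y = 1 /\ y * val u = 1} :=
  cid (set_valP u).

Let is_unitV (u : units) : is_unit (sval (inv_ex u)).
Proof. by case: (inv_ex u) => y [uy yu]; exists (val u). Qed.

Definition units_one : units := unit_mk is_unit1.
Definition units_mul (u v : units) : units :=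
  unit_mk (is_unitM (set_valP u) (set_valP v)).
Definition units_inv (u : units) : units := unit_mk (is_unitV u).

Let units_mulA : associative units_mul.
Proof. by move=> u v w; apply: val_inj; exact: mulrA. Qed.

Let units_mul1 : left_id units_one units_mul.
Proof. by move=> u; apply: val_inj; exact: mul1r. Qed.

Let units_mulr1 : right_id units_one units_mul.
Proof. by move=> u; apply: val_inj; exact: mulr1. Qed.

Let units_mulV : left_inverse units_one units_inv units_mul.
Proof. by move=> u; apply: val_inj => /=; case: (inv_ex u) => y []. Qed.

Let units_mulrV : right_inverse units_one units_inv units_mul.
Proof. by move=> u; apply: val_inj => /=; case: (inv_ex u) => y []. Qed.

HB.instance Definition _ := isGroup.Build units
  units_mulA units_mul1 units_mulr1 units_mulV units_mulrV.

End Units.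

(* [set_type] carries the subspace topology. *)
HB.instance Definition _ (R : preTopologicalPzRingType) :=
  Topological.copy (units R) (set_type (@is_unit R)).

Definition absolute (P : topologicalNzRingType) : Prop :=
  is_topological_group (units P).

Section IncidenceRing.
Context {d : Order.disp_t} (L : porderType d).

Definition order_supported (P : pzRingType) : {pred L * L -> P} :=
  fun a => `[< forall s1 s2, a (s1, s2) != 0 -> (s1 <= s2)%O >].

Record incidence (Llf : locally_finite L) (P : pzRingType) := Incidence {
  incidence_fun :> L * L -> P;
  _ : incidence_fun \in @order_supported P
}.

Variables (Llf : locally_finite L) (P : pzRingType).
Local Notation M := (incidence Llf P).
Local Notation supp := (@order_supported P).

HB.instance Definition _ := [isSub for @incidence_fun Llf P].
HB.instance Definition _ := [Choice of M by <:].

Lemma order_supportedP (a : L * L -> P) :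
  reflect (forall s1 s2, ~~ (s1 <= s2)%O -> a (s1, s2) = 0) (a \in supp).
Proof.
apply: (iffP (asboolP _)) => h s1 s2; first by apply: contraNeq; exact: h.
by apply: contraNT => /h ->.
Qed.

Fact order_supported_zmod : zmod_closed supp.
Proof.
split; first exact/order_supportedP.
move=> a b /order_supportedP ha /order_supportedP hb.
apply/order_supportedP => s1 s2 s12.
have -> : (a - b) (s1, s2) = a (s1, s2) - b (s1, s2) by [].
by rewrite ha// hb// subr0.
Qed.
HB.instance Definition _ := GRing.isZmodClosed.Build _ supp order_supported_zmod.

HB.instance Definition _ := [SubChoice_isSubZmodule of M by <:].

Definition incidence_mul_fun (a b : L * L -> P) : L * L -> P :=
  fun s => \sum_(t \in order_interval s.1 s.2) a (s.1, t) * b (t, s.2).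

Definition incidence_one_fun : L * L -> P := fun s => (s.1 == s.2)%:R.

Fact incidence_mul_supported (a b : M) : incidence_mul_fun a b \in supp.
Proof.
apply/order_supportedP => s1 s2 s12; apply: fsbig1 => t /= /andP[s1t ts2].
by rewrite (le_trans s1t ts2) in s12.
Qed.

Fact incidence_one_supported : incidence_one_fun \in supp.
Proof.
apply/order_supportedP => s1 s2; rewrite /incidence_one_fun /=.
by case: eqVneq => // ->; rewrite lexx.
Qed.

Definition incidence_mul (a b : M) : M :=
  Incidence Llf (incidence_mul_supported a b).

Definition incidence_one : M := Incidence Llf incidence_one_supported.

Lemma incidenceD (a b : M) s : (a + b) s = a s + b s.
Proof. by rewrite -[LHS]/(val (a + b) s) raddfD. Qed.

Lemma incidenceP (a b : M) : (forall s1 s2, a (s1, s2) = b (s1, s2)) -> a = b.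
Proof. by move=> ab; apply: val_inj; apply/funext => -[s1 s2]; exact: ab. Qed.

Lemma incidence_eq0 (a : M) s1 s2 : ~~ (s1 <= s2)%O -> a (s1, s2) = 0.
Proof. by move=> s12; apply: (order_supportedP _ (valP a)). Qed.

Lemma incidence_mulE (D : set L) (a b : M) s1 s2 : finite_set D ->
  order_interval s1 s2 `<=` D ->
  incidence_mul a b (s1, s2) = \sum_(t <- fset_set D) a (s1, t) * b (t, s2).
Proof.
move=> finD sD; rewrite -fsbig_finite//; apply: fsbig_widen => // t [_ /= /negP].
rewrite negb_and => /orP[s1t|ts2].
  by rewrite (incidence_eq0 a s1t) mul0r.
by rewrite (incidence_eq0 b ts2) mulr0.
Qed.

Let mE (a b : M) s1 s2 :
  incidence_mul a b (s1, s2) =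
  \sum_(t <- fset_set (order_interval s1 s2)) a (s1, t) * b (t, s2).
Proof. exact: incidence_mulE. Qed.

Let mulA : associative incidence_mul.
Proof.
move=> a b c; apply: incidenceP => s1 s2.
rewrite !mE.
have [s12|s12] := boolP (s1 <= s2)%O; last first.
  rewrite !big_seq !big1// => t; rewrite in_fset_set ?inE// => /andP[s1t ts2];
  by rewrite (le_trans s1t ts2) in s12.
pose r := fset_set (order_interval s1 s2).
transitivity (\sum_(t <- r) \sum_(u <- r) a (s1, t) * b (t, u) * c (u, s2)).
  rewrite big_seq [RHS]big_seq; apply: eq_bigr => t.
  rewrite in_fset_set ?inE// => /andP[s1t ts2].
  rewrite (@incidence_mulE (order_interval s1 s2))//; last first.
    by move=> u /= /andP[tu us2]; apply/andP; rewrite (le_trans s1t tu).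
  by rewrite mulr_sumr; apply: eq_bigr => u _; rewrite mulrA.
rewrite exchange_big big_seq [RHS]big_seq; apply: eq_bigr => t.
rewrite in_fset_set ?inE// => /andP[s1t ts2].
rewrite (@incidence_mulE (order_interval s1 s2))//; last first.
  by move=> u /= /andP[s1u ut]; apply/andP; rewrite s1u (le_trans ut ts2).
by rewrite mulr_suml.
Qed.

Let mul1 : left_id incidence_one incidence_mul.
Proof.
move=> a; apply: incidenceP => s1 s2.
have [s12|s12] := boolP (s1 <= s2)%O; last by rewrite !incidence_eq0.
rewrite mE (bigD1_seq s1) ?fset_uniq//=; last first.
  by rewrite in_fset_set// inE /order_interval /= lexx.
rewrite {1}/incidence_one_fun /= eqxx mul1r big1 ?addr0// => t ts1.
by rewrite /incidence_one_fun /= eq_sym (negPf ts1) mul0r.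
Qed.

Let mulr1 : right_id incidence_one incidence_mul.
Proof.
move=> a; apply: incidenceP => s1 s2.
have [s12|s12] := boolP (s1 <= s2)%O; last by rewrite !incidence_eq0.
rewrite mE (bigD1_seq s2) ?fset_uniq//=; last first.
  by rewrite in_fset_set// inE /order_interval /= lexx andbT.
rewrite {1}/incidence_one_fun /= eqxx mulr1 big1 ?addr0// => t ts1.
by rewrite /incidence_one_fun /= (negPf ts1) mulr0.
Qed.

Let mulDl : left_distributive incidence_mul +%R.
Proof.
move=> a b c; apply: incidenceP => s1 s2.
rewrite incidenceD !mE -big_split.
by apply: eq_bigr => t _; rewrite incidenceD/= mulrDl.
Qed.

Let mulDr : right_distributive incidence_mul +%R.
Proof.
move=> a b c; apply: incidenceP => s1 s2.
rewrite incidenceD !mE -big_split.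
by apply: eq_bigr => t _; rewrite incidenceD/= mulrDr.
Qed.

HB.instance Definition _ :=
  GRing.Zmodule_isPzRing.Build M mulA mul1 mulr1 mulDl mulDr.

End IncidenceRing.

HB.instance Definition _ d (L : porderType d) (Llf : locally_finite L)
    (P : topologicalNzRingType) :=
  Topological.copy (incidence Llf P)
    (initial_topology (@incidence_fun _ L Llf P : _ -> {ptws L * L -> P})).

Definition GL d (L : porderType d) (Llf : locally_finite L)
  (P : topologicalNzRingType) : preTopologicalGroupType := units (incidence Llf P).

(* Main.v *)
(** For k : nat let U_k be the set of invertible x such that x - 1 vanishes at
    every (s, t) for which the interval [s, t] has at most k elements.  The
    matrices vanishing at these positions form a two-sided ideal, so U_k is a
    subgroup, and it is closed because P is Hausdorff.  With X = x - 1 and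
    Y = y - 1,
      [x, y] - 1 = x^-1 y^-1 (xy - yx) = x^-1 y^-1 (XY - YX),
    and for k >= 1 products such as XY of matrices vanishing on intervals of
    cardinality at most k vanish on intervals of cardinality at most k + 1; for
    k = 0, commutativity of P makes the diagonal of xy - yx vanish.  Hence the
    k-th derived subgroup lies in U_k.  The U_k intersect trivially, and
    U_n = 1 if the poset is n-bounded. *)

Require Import Defs.
From mathcomp Require Import all_boot all_order all_algebra finmap.
From mathcomp Require Import all_classical all_reals all_analysis.

Set Implicit Arguments.
Unset Strict Implicit.
Unset Printing Implicit Defensive.

Import Order.TTheory GRing.Theory.

Local Open Scope classical_set_scope.
Local Open Scope ring_scope.

Section DerivedSeries.
Variable G : preTopologicalGroupType.
Implicit Types A H : set G.

Lemma derived_series1 k : derived_series G k 1%g.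
Proof.
by case: k => [|k] //; apply: subset_closure => H /= [[H1 _ _] _].
Qed.

(** Minimality of the generated subgroup and of the closure reduces the inductive step on the
    derived series to single commutators. *)
Lemma closure_commutator_sub A H : is_subgroup H -> closed H ->
  (forall x y, A x -> A y -> H [~ x, y]%g) ->
  closure (commutator_subgroup A) `<=` H.
Proof.
move=> sgH /closure_id clH commH; rewrite clH; apply: closureS.
by apply: smallest_sub => // _ [x Ax [y Ay <-]]; exact: commH.
Qed.

End DerivedSeries.

Section IntervalCardinality.
Context {d : Order.disp_t} {L : porderType d}.
Hypothesis Llf : locally_finite L.
Implicit Types s t u : L.

(** [fset_set] sends infinite sets to the empty set, so this is the true cardinality only under
    local finiteness. It is 0 when s <= t fails. *)
Definition interval_card s t : nat := #|` fset_set (order_interval s t)|.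

Lemma interval_card_homo s t s' t' :
  (s <= s')%O -> (t' <= t)%O -> (interval_card s' t' <= interval_card s t)%N.
Proof.
move=> ss' t't; apply: fsubset_leq_card; rewrite -fset_set_sub//.
by move=> u /andP[s'u ut']; apply/andP; rewrite (le_trans ss')// (le_trans ut').
Qed.

Lemma interval_card_lt s u t :
  (s <= u)%O -> (u < t)%O -> (interval_card s u < interval_card s t)%N.
Proof.
move=> su ut; apply: fproper_ltn_card; rewrite fproperE; apply/andP; split.
  rewrite -fset_set_sub// => v /andP[sv vu].
  by apply/andP; rewrite sv (le_trans vu (ltW ut)).
apply/fsubsetPn; exists t.
  by rewrite in_fset_set// inE /order_interval/= lexx (le_trans su (ltW ut)).
by rewrite in_fset_set//; apply/negP; rewrite inE => /andP[_]; rewrite lt_geF.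
Qed.

Lemma interval_card_gt0 s t : (s <= t)%O -> (0 < interval_card s t)%N.
Proof.
move=> st; rewrite cardfs_gt0; apply/fset0Pn; exists s.
by rewrite in_fset_set// inE /order_interval/= lexx.
Qed.

Lemma interval_cardxx s : interval_card s s = 1%N.
Proof.
apply/eqP/cardfs1P; exists s; apply/fsetP => t.
rewrite in_fset_set// in_fset1; apply/idP/eqP => [|->].
  by rewrite inE => /andP[st ts]; apply/le_anti/andP.
by rewrite inE /order_interval/= lexx.
Qed.

(** The interval [s, t] consists of elements comparable to s. *)
Lemma n_bounded_interval_card n s t :
  n_bounded L n -> (s <= t)%O -> (interval_card s t <= n)%N.
Proof.
move=> nL st; apply: geq_card_fset_set; apply: card_le_trans (nL s).
by apply: subset_card_le => u /andP[su _]; right.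
Qed.

End IntervalCardinality.

Section VanishingIdeals.
Context {d : Order.disp_t} {L : porderType d}.
Variables (Llf : locally_finite L) (P : pzRingType).
Implicit Types (a b : incidence Llf P) (s t : L) (k : nat).

Definition vanishing k a : Prop :=
  forall s t, (interval_card s t <= k)%N -> a (s, t) = 0.

Lemma incidenceME a b s t :
  (a * b) (s, t) =
  \sum_(u <- fset_set (order_interval s t)) a (s, u) * b (u, t).
Proof. exact: incidence_mulE. Qed.

Lemma incidence1E s t : (1 : incidence Llf P) (s, t) = (s == t)%:R.
Proof. by []. Qed.

Lemma incidenceN a p : (- a) p = - a p.
Proof. by rewrite -[LHS]/(val (- a) p) raddfN. Qed.

(** Empty intervals occur only where s <= t fails, outside the support of an incidence matrix. *)
Lemma vanishing0 a : vanishing 0 a.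
Proof.
move=> s t st; apply: incidence_eq0; apply: contraTN st => /interval_card_gt0.
by rewrite -ltnNge; apply.
Qed.

Lemma vanishingD k a b : vanishing k a -> vanishing k b -> vanishing k (a + b).
Proof. by move=> va vb s t st; rewrite incidenceD va// vb// addr0. Qed.

Lemma vanishingN k a : vanishing k a -> vanishing k (- a).
Proof. by move=> va s t st; rewrite incidenceN va// oppr0. Qed.

Lemma vanishingMl k a b : vanishing k b -> vanishing k (a * b).
Proof.
move=> vb s t st; rewrite incidenceME big_seq big1// => u.
rewrite in_fset_set// inE => /andP[su ut].
by rewrite vb ?mulr0// (leq_trans _ st)// interval_card_homo.
Qed.

(** In the sum over u in [s, t], the term u = t dies because b is zero on the diagonal, which is why
    the index starts at 1. For u < t, the interval [s, u] omits t, so it is strictly smaller than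
    [s, t] and a (s, u) = 0. *)
Lemma vanishingMS k a b :
  vanishing k.+1 a -> vanishing k.+1 b -> vanishing k.+2 (a * b).
Proof.
move=> va vb s t st; rewrite incidenceME big_seq big1// => u.
rewrite in_fset_set// inE => /andP[su].
rewrite le_eqVlt => /predU1P[->|ut].
  by rewrite vb ?mulr0// interval_cardxx.
rewrite va ?mul0r// -ltnS (leq_trans _ st)//.
exact: interval_card_lt.
Qed.

End VanishingIdeals.

Lemma vanishing_commutator1 d (L : porderType d) (Llf : locally_finite L)
    (P : comPzRingType) (a b : incidence Llf P) : vanishing 1 (a * b - b * a).
Proof.
move=> s t st1; have [st|st] := boolP (s <= t)%O; last first.
  exact: incidence_eq0.
(* If s < t, then [s, t] properly contains [s, s] and has at least two elements. *)
have {st1}-> : t = s.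
  move: st; rewrite le_eqVlt => /predU1P[//|st].
  have := interval_card_lt Llf (lexx s) st.
  by rewrite interval_cardxx// ltnNge st1.
(* At u = s the two products agree by commutativity of [P]. For any other u, antisymmetry excludes s
   <= u or u <= s, so both products contain a zero entry. *)
rewrite incidenceD incidenceN !incidenceME -sumrB big1// => u _.
have [us|us] := eqVneq u s; first by rewrite us mulrC subrr.
have [su|su] := boolP (s <= u)%O; last first.
  by rewrite !(incidence_eq0 _ su) !mul0r subrr.
have nus : ~~ (u <= s)%O.
  by apply: contra_neqN us => us; apply/le_anti/andP.
by rewrite !(incidence_eq0 _ nus) !mulr0 subrr.
Qed.

Section CongruenceSubgroups.
Context {d : Order.disp_t} {L : porderType d}.
Variables (Llf : locally_finite L) (P : topologicalNzRingType).
Implicit Types (x y : GL Llf P) (s t : L) (k : nat).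

Definition congruence_subgroup k : set (GL Llf P) :=
  [set x | vanishing k (val x - 1)].

Lemma congruence_subgroup_is_subgroup k : is_subgroup (congruence_subgroup k).
Proof.
split=> [|x y vx vy|x vx]; rewrite /congruence_subgroup/=.
- by rewrite subrr => s t _; rewrite -[LHS]/(val (0 : incidence Llf P) _) raddf0.
- have -> : val (x * y)%g - 1 = val x * (val y - 1) + (val x - 1).
    by rewrite mulrBr mulr1 addrA subrK.
  by apply: vanishingD => //; exact: vanishingMl.
- have VK : val (x^-1)%g * val x = 1 by exact: (congr1 val (mulVg x)).
  have -> : val (x^-1)%g - 1 = - (val (x^-1)%g * (val x - 1)).
    by rewrite mulrBr mulr1 VK opprB.
  by apply/vanishingN/vanishingMl.
Qed.

Lemma GL_coord_continuous s t :
  continuous (fun x : GL Llf P => (val x : incidence Llf P) (s, t)).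
Proof.
(* The coordinate map is the inclusion of the units, then the inclusion into the product, then a
   projection; the first two are continuous because their sources carry initial topologies. *)
move=> x; pose U := set_type (@is_unit (incidence Llf P)).
pose f (a : incidence Llf P) : {ptws L * L -> P} := a.
apply: (@continuous_comp U _ _ (fun u => f (set_val u)) (proj (s, t)) x).
  apply: (@continuous_comp U _ _ set_val f x); exact: initial_continuous.
exact: (@proj_continuous _ (fun=> P) (s, t)).
Qed.

Lemma closed_congruence_subgroup k :
  hausdorff_space P -> closed (congruence_subgroup k).
Proof.
move=> P_hausdorff.
(* One closed condition per short interval: the entry equals 1 on the diagonal and 0 elsewhere. *)
have -> : congruence_subgroup k =
    \bigcap_(p in [set p : L * L | (interval_card p.1 p.2 <= k)%N])
      ((fun x : GL Llf P => (val x : incidence Llf P) (p.1, p.2)) @^-1`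
        [set (p.1 == p.2)%:R]).
  apply/seteqP; split=> x /= Ux.
    move=> [s t] /= /Ux; rewrite incidenceD incidenceN incidence1E.
    by move/eqP; rewrite subr_eq0 => /eqP.
  move=> s t st; rewrite incidenceD incidenceN incidence1E.
  by apply/eqP; rewrite subr_eq0; apply/eqP; exact: (Ux (s, t)).
apply: closed_bigI => p _; apply: preimage_closed.
  by move=> x _; exact: GL_coord_continuous.
exact/accessible_closed_set1/hausdorff_accessible.
Qed.

(** Letting k depend on the entry (s, t) serves both claims: k is the cardinality of [s, t] for
    residual solvability, and the constant n in the bounded case. *)
Lemma congruence_subgroup_eq1 x :
  (forall s t, (s <= t)%O ->
     exists2 k, (interval_card s t <= k)%N & congruence_subgroup k x) ->
  x = 1%g.
Proof.
move=> Ux; apply: val_inj; apply/eqP; rewrite -subr_eq0; apply/eqP.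
apply: incidenceP => s t; rewrite -[RHS]/(val (0 : incidence Llf P) (s, t)).
rewrite raddf0; have [st|st] := boolP (s <= t)%O; last exact: incidence_eq0.
by have [k kst] := Ux s t st; apply.
Qed.

End CongruenceSubgroups.

Lemma congruence_subgroup_comm d (L : porderType d) (Llf : locally_finite L)
    (P : topologicalComNzRingType) k (x y : GL Llf P) :
  congruence_subgroup k x -> congruence_subgroup k y ->
  congruence_subgroup k.+1 [~ x, y]%g.
Proof.
rewrite /congruence_subgroup/= => vx vy.
have commE : val [~ x, y]%g - 1 =
    val (x^-1 * y^-1)%g * (val x * val y - val y * val x).
  rewrite mulrBr; congr (_ - _).
    rewrite -[RHS]/(val ((x^-1 * y^-1) * (x * y))%g).
    by rewrite commgEl conjgE !mulgA.
  rewrite -[RHS]/(val ((x^-1 * y^-1) * (y * x))%g).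
  by rewrite -mulgA mulKg mulVg.
rewrite commE; apply: vanishingMl.
case: k => [|k] in vx vy *; first exact: vanishing_commutator1.
have -> : val x * val y - val y * val x =
    (val x - 1) * (val y - 1) - (val y - 1) * (val x - 1).
  (* The correction a + b - 1 is symmetric in a and b, so it cancels in the difference of the two
     products. *)
  have mulB1 a b : (a - 1) * (b - 1) = a * b - (a + b - 1) :> incidence Llf P.
    by rewrite mulrBl mulrBr mulr1 mul1r -addrA -opprD addrA.
  rewrite !mulB1 [val y + _]addrC.
  by move: (_ + _ - 1) => c; rewrite opprB subrKA.
by apply: vanishingD; [|apply: vanishingN]; exact: vanishingMS.
Qed.

Lemma derived_series_sub_congruence d (L : porderType d)
    (Llf : locally_finite L) (P : topologicalComNzRingType) k :
  hausdorff_space P -> derived_series (GL Llf P) k `<=` congruence_subgroup k.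
Proof.
move=> P_hausdorff; elim: k => [|k IHk] => [x _|]; first exact: vanishing0.
apply: closure_commutator_sub.
- exact: congruence_subgroup_is_subgroup.
- exact: closed_congruence_subgroup.
- by move=> x y /IHk Ux /IHk Uy; exact: congruence_subgroup_comm.
Qed.

Unset Implicit Arguments.

Theorem lemma3p23 (d : Order.disp_t) (L : porderType d)
    (Llf : locally_finite L) (P : topologicalComNzRingType)
    (P_hausdorff : hausdorff_space P) (P_absolute : absolute P) :
  residually_solvable (GL Llf P) /\
  (forall n : nat, n_bounded L n ->
     solvable (GL Llf P) /\ derived_series (GL Llf P) n = [set 1%g]).
Proof.
split.
  apply/seteqP; split=> [x Gx /=|_ -> k _]; last exact: derived_series1.
  apply: congruence_subgroup_eq1 => s t _; exists (interval_card s t) => //.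
  exact: derived_series_sub_congruence (Gx _ I).
move=> n nL; suff Gn1 : derived_series (GL Llf P) n = [set 1%g].
  by split=> //; exists n.
apply/seteqP; split=> [x Gx /=|_ ->]; last exact: derived_series1.
apply: congruence_subgroup_eq1 => s t st; exists n.
  exact: n_bounded_interval_card nL st.
exact: derived_series_sub_congruence Gx.
Qed.
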